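(* Let $S$ be the multiset consisting of $2$ copies of each odd positive integer together with $2$ additional copies of each odd positive multiple of $3$, and let $T$ be the multiset consisting of $2$ copies of each even positive integer together with $2$ additional copies of each even positive multiple of $3$ (all copies distinct). Let $D_S(N)$ be the number of partitions of $N$ into distinct elements of $S$ having an odd number of parts, and $D_T(N)$ the number of partitions of $N$ into distinct elements of $T$. Then for every $N\ge 1$, $D_S(N)=2D_T(N-1)$.
   Context: A partition of $N$ into distinct elements of a multiset is a finite set of distinct elements of it (different copies of the same integer count as distinct elements) whose values sum to $N$. $D_T(0)=1$. *)

(* Defs.v *)
From mathcomp Require Import all_boot.
Set Implicit Arguments. Unset Strict Implicit. Unset Printing Implicit Defensive.

(* A multiset of positive integers is given by its multiplicity function
   m : nat -> nat (m k = number of distinct copies of k).  All multiplicities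
   used here are <= 4, so a copy of k is a pair (k, c) with c < m k, c : 'I_4. *)

Definition mS (k : nat) : nat :=
  if (0 < k) && odd k then (if 3 %| k then 4 else 2) else 0.

Definition mT (k : nat) : nat :=
  if (0 < k) && ~~ odd k then (if 3 %| k then 4 else 2) else 0.

(* A partition of N into distinct elements of the multiset m: a finite set A
   of distinct copies (k, c) (k a positive integer, c < m k), whose values k
   sum to N.  Every part is <= N, so copies live in 'I_N.+1 * 'I_4. *)
Definition is_dpart (m : nat -> nat) (N : nat) (A : {set 'I_N.+1 * 'I_4}) : bool :=
  [forall x in A, (0 < x.1) && (x.2 < m x.1)] && (\sum_(x in A) (x.1 : nat) == N).

Definition D (m : nat -> nat) (N : nat) : nat :=
  #|[set A : {set 'I_N.+1 * 'I_4} | is_dpart m A]|.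

Definition D_odd (m : nat -> nat) (N : nat) : nat :=
  #|[set A : {set 'I_N.+1 * 'I_4} | is_dpart m A && odd #|A|]|.

Definition D_S (N : nat) : nat := D_odd mS N.
Definition D_T (N : nat) : nat := D mT N.

(* Main.v *)
(* Attaching the sign (-1)^(number of parts), the claim becomes F(q) - F(-q) = 4 q G(q^2), where
   F and G(q^2) are the generating functions of partitions into distinct elements of S and T.
   After multiplication by (q^2; q^2) (q^6; q^6), the Jacobi triple product turns it into
   phi(q) phi(q^3) - phi(-q) phi(-q^3) = 4 q psi(q^2) psi(q^6), with phi(q) = sum_(x in Z) q^(x^2)
   and 2 psi(q^2) = sum_(x in Z) q^(x(x-1)), which follows by counting the representations
   of an odd N by x^2 + 3 y^2 and of 4 N by a^2 + 3 b^2 with a, b odd.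
   Everything is truncated: the triple product is replaced by the finite q-binomial theorem,
   and equality of series by congruence modulo a power of q. *)

Require Import Defs.
From mathcomp Require Import all_boot all_algebra.
From mathcomp Require Import zify ring.

Set Implicit Arguments. Unset Strict Implicit. Unset Printing Implicit Defensive.
Import GRing.Theory.
Local Open Scope ring_scope.

Definition congr_pow (R : comNzRingType) (q : R) (M : nat) (p r : R) :=
  exists h, p = r + q ^+ M * h.

Section CongrPow.
Variables (R : comNzRingType) (q : R) (M : nat).
Local Notation "p == r" := (congr_pow q M p r).

Lemma congr_pow_refl p : p == p.
Proof. by exists 0; rewrite mulr0 addr0. Qed.

Lemma congr_pow_sym p r : p == r -> r == p.
Proof. by case=> h ->; exists (- h); ring. Qed.

Lemma congr_pow_trans p r s : p == r -> r == s -> p == s.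
Proof. by move=> [h ->] [k ->]; exists (h + k); ring. Qed.

Lemma congr_powD p1 r1 p2 r2 : p1 == r1 -> p2 == r2 -> p1 + p2 == r1 + r2.
Proof. by move=> [h ->] [k ->]; exists (h + k); ring. Qed.

Lemma congr_powB p1 r1 p2 r2 : p1 == r1 -> p2 == r2 -> p1 - p2 == r1 - r2.
Proof. by move=> [h ->] [k ->]; exists (h - k); ring. Qed.

Lemma congr_powM p1 r1 p2 r2 : p1 == r1 -> p2 == r2 -> p1 * p2 == r1 * r2.
Proof.
by move=> [h ->] [k ->]; exists (h * r2 + r1 * k + q ^+ M * h * k); ring.
Qed.

Lemma congr_pow_sum (I : Type) (s : seq I) (F G : I -> R) :
  (forall i, F i == G i) -> \sum_(i <- s) F i == \sum_(i <- s) G i.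
Proof.
move=> FG; elim/big_ind2: _ => //; first exact: congr_pow_refl.
by move=> *; apply: congr_powD.
Qed.

Lemma congr_pow_prod1 (I : Type) (s : seq I) (P : pred I) (F : I -> R) :
  (forall i, P i -> F i == 1) -> \prod_(i <- s | P i) F i == 1.
Proof.
move=> F1; elim/big_ind: _ => //; first exact: congr_pow_refl.
by move=> x y x1 y1; rewrite -(mulr1 1); apply: congr_powM.
Qed.

Lemma congr_pow_exp1 p n : p == 1 -> p ^+ n == 1.
Proof.
move=> p1; elim: n => [|n IHn]; first exact: congr_pow_refl.
by rewrite exprS -[X in congr_pow _ _ _ X](mulr1 1); apply: congr_powM.
Qed.

(* Such a [u] is invertible modulo [q ^+ M], by the truncated geometric series. *)
Lemma congr_pow_cancel u p r :
  congr_pow q 1 u 1 -> u * p == u * r -> p == r.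
Proof.
case=> w uE [h E].
have [v uv]: exists v, v * u == 1.
  exists (\sum_(i < M) (- (q * w)) ^+ i), (- (- w) ^+ M).
  have -> : u = 1 - - (q * w) by rewrite uE; ring.
  by rewrite mulrC -opprB mulNr -subrX1 -mulrN exprMn; ring.
have vp s : s == v * u * s.
  by rewrite -{1}(mul1r s); apply: congr_powM (congr_pow_refl s); apply: congr_pow_sym.
apply: congr_pow_trans (vp p) _; apply: congr_pow_trans (congr_pow_sym (vp r)).
by exists (v * h); rewrite -!mulrA E; ring.
Qed.

End CongrPow.

Lemma congr_pow_weaken (R : comNzRingType) (q : R) (k M M' : nat) p r :
  (M' <= k * M)%N -> congr_pow (q ^+ k) M p r -> congr_pow q M' p r.
Proof.
move=> le [h ->]; exists (q ^+ (k * M - M') * h).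
by rewrite mulrA -exprD subnKC // -exprM.
Qed.

Section QBinomial.
Variables (R : comNzRingType) (Q : R).

Fixpoint qbinom (m k : nat) : R :=
  match m, k with
  | _, 0 => 1
  | 0, _.+1 => 0
  | m'.+1, k'.+1 => Q ^+ (m' - k') * qbinom m' k' + qbinom m' k
  end.

Definition qpoch (n : nat) : R := \prod_(i < n) (1 - Q ^+ i.+1).

Lemma qbinom0 m : qbinom m 0 = 1.
Proof. by case: m. Qed.

Lemma qbinom_small m k : (m < k)%N -> qbinom m k = 0.
Proof.
elim: m k => [|m IHm] [|k] //= lt_mk; rewrite !IHm ?mulr0 ?addr0 //; lia.
Qed.

Lemma qbinom_thm (x y : R) m :
  \prod_(i < m) (x + y * Q ^+ i) =
  \sum_(k < m.+1) qbinom m k * Q ^+ 'C(k, 2) * x ^+ (m - k) * y ^+ k.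
Proof.
elim: m => [|m IHm]; first by rewrite big_ord0 big_ord1 /=; ring.
rewrite big_ord_recr IHm /= mulrDr !mulr_suml big_ord_recl /=.
have E (k : 'I_m.+1) :
  qbinom m.+1 k.+1 * Q ^+ 'C(k.+1, 2) * x ^+ (m.+1 - k.+1) * y ^+ k.+1 =
  qbinom m k * Q ^+ 'C(k, 2) * x ^+ (m - k) * y ^+ k * (y * Q ^+ m) +
  qbinom m k.+1 * Q ^+ 'C(k.+1, 2) * x ^+ (m - k) * y ^+ k.+1.
  have -> : Q ^+ m = Q ^+ (m - k) * Q ^+ k by rewrite -exprD subnK // -ltnS.
  rewrite /= subSS binS bin1 exprD exprS; ring.
rewrite [RHS]big_ord_recl [in RHS](eq_bigr _ (fun k _ => E k)) big_split /=.
have -> : \sum_(k < m.+1) qbinom m k.+1 * Q ^+ 'C(k.+1, 2) * x ^+ (m - k) * y ^+ k.+1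
  = \sum_(k < m) qbinom m (bump 0 k) * Q ^+ 'C(bump 0 k, 2) * x ^+ (m - bump 0 k)
      * y ^+ bump 0 k * x.
  rewrite big_ord_recr /= qbinom_small // !mul0r addr0; apply: eq_bigr => k _.
  have -> : (m - k = (m - k.+1).+1)%N by have := ltn_ord k; lia.
  by rewrite /bump /= add1n exprS; ring.
by rewrite !qbinom0 !subn0 !bin0n exprS; ring.
Qed.

Lemma qpochS n : qpoch n.+1 = qpoch n * (1 - Q ^+ n.+1).
Proof. by rewrite /qpoch big_ord_recr. Qed.

Lemma qbinom_qpoch a b : qbinom (a + b) a * qpoch a * qpoch b = qpoch (a + b).
Proof.
have [n] := ubnP (a + b); elim: n a b => // n IHn [|a] [|b] lt_n.
- by rewrite /= /qpoch big_ord0; ring.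
- by rewrite qbinom0 /qpoch big_ord0 add0n; ring.
- have -> : qbinom (a.+1 + 0) a.+1 = 1.
    by rewrite addn0; elim: a.+1 => //= k ->; rewrite subnn qbinom_small //; ring.
  by rewrite /qpoch big_ord0 addn0; ring.
have IH1 : qbinom (a + b.+1) a * qpoch a * qpoch b.+1 = qpoch (a + b.+1) by apply: IHn; lia.
have IH2 : qbinom (a + b.+1) a.+1 * qpoch a.+1 * qpoch b = qpoch (a + b.+1).
  by rewrite addnS -addSn; apply: IHn; lia.
rewrite addSn [qbinom _ _]/= addKn [in RHS]qpochS.
transitivity (qpoch (a + b.+1) * ((1 - Q ^+ a.+1) * Q ^+ b.+1)
   + qpoch (a + b.+1) * (1 - Q ^+ b.+1)).
  by rewrite -{1}IH1 -IH2 [qpoch a.+1]qpochS [qpoch b.+1]qpochS; ring.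
have -> : Q ^+ (a + b.+1).+1 = Q ^+ a.+1 * Q ^+ b.+1 by rewrite -exprD addSn.
ring.
Qed.

Lemma qpoch_congr a n : (a <= n)%N -> congr_pow Q a.+1 (qpoch n) (qpoch a).
Proof.
move/subnKC <-; elim: (n - a)%N => [|k [h IHk]]; first by rewrite addn0; apply: congr_pow_refl.
rewrite addnS qpochS IHk -addSn exprD.
exists (h - Q ^+ k * (qpoch a + Q ^+ a.+1 * h)); ring.
Qed.

Lemma qpoch_congr1 n : congr_pow Q 1 (qpoch n) 1.
Proof. by have := @qpoch_congr 0 n isT; rewrite {2}/qpoch big_ord0. Qed.

Lemma qpoch_qbinom_congr n a b : (minn a b <= n)%N ->
  congr_pow Q (minn a b).+1 (qpoch n * qbinom (a + b) a) 1.
Proof.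
set c := minn a b => le_cn.
have cE d : (c <= d)%N -> congr_pow Q c.+1 (qpoch d) (qpoch n).
  move=> /qpoch_congr cd; apply: congr_pow_trans cd _.
  by apply: congr_pow_sym; apply: qpoch_congr.
apply: (congr_pow_cancel (qpoch_congr1 n)).
apply: congr_pow_trans (_ : congr_pow Q c.+1 _ (qbinom (a + b) a * qpoch a * qpoch b)) _.
  have -> : qpoch n * (qpoch n * qbinom (a + b) a) = qbinom (a + b) a * qpoch n * qpoch n by ring.
  apply: congr_powM; first (apply: congr_powM; first exact: congr_pow_refl).
    by apply: congr_pow_sym; apply: cE; rewrite /c; lia.
  by apply: congr_pow_sym; apply: cE; rewrite /c; lia.
by rewrite qbinom_qpoch mulr1; apply: cE; rewrite /c; lia.
Qed.

End QBinomial.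

Definition zrange (n m : nat) : seq int := [seq k%:Z - n%:Z | k <- index_iota 0 m].

Lemma mem_zrange n m (x : int) : (x \in zrange n m) = (- n%:Z <= x < m%:Z - n%:Z).
Proof.
apply/mapP/idP => [[k]|/andP[x1 x2]].
  by rewrite mem_index_iota => /andP[_ km] ->; lia.
by exists (absz (x + n%:Z)); rewrite ?mem_index_iota; lia.
Qed.

Lemma zrange_uniq n m : uniq (zrange n m).
Proof. by rewrite map_inj_uniq ?iota_uniq // => i j; lia. Qed.

Definition phi_exp (x : int) : nat := absz (x * x).
Definition psi_exp (x : int) : nat := absz (x * (x - 1)).

Section Theta.
Variables (R : idomainType) (q : R).
Hypothesis q_neq0 : q != 0.

(* For [m] odd the symmetric product on the left gives phi, for [m] even psi; [q ^+ e] is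
   what remains of it when each factor is normalised to the form [1 + q ^+ i]. *)
Lemma theta_congr (m n e M : nat) (f : nat -> nat) (P : R) :
  \prod_(k < m.+1) (q ^+ m + q ^+ 2 ^+ k) = q ^+ e * P ->
  (forall k, (k <= m.+1)%N ->
    (e + f k = 2 * 'C(k, 2) + m * (m.+1 - k))%N /\
    (M <= f k + 2 * (minn k (m.+1 - k)).+1)%N /\ (minn k (m.+1 - k) <= n)%N) ->
  congr_pow q M (qpoch (q ^+ 2) n * P) (\sum_(k < m.+2) q ^+ f k).
Proof.
move=> prodE fP.
have -> : P = \sum_(k < m.+2) qbinom (q ^+ 2) m.+1 k * q ^+ f k.
  apply: (mulfI (expf_neq0 e q_neq0)); rewrite -prodE mulr_sumr.
  under eq_bigr do rewrite -[X in _ + X]mul1r.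
  rewrite qbinom_thm; apply: eq_bigr => k _.
  rewrite expr1n mulr1 mulrCA -exprD -mulrA; congr (_ * _).
  have [-> _] := fP k (ltn_ord k).
  by rewrite exprD !exprM.
rewrite mulr_sumr; apply: congr_pow_sum => k.
have [_ [le_M le_n]] := fP k (ltn_ord k).
have := @qpoch_qbinom_congr R (q ^+ 2) n k (m.+1 - k) le_n.
rewrite subnKC -1?ltnS // => -[h E].
exists (q ^+ (f k + 2 * (minn k (m.+1 - k)).+1 - M) * h).
rewrite mulrA E mulrA -exprD subnKC // exprD exprM; ring.
Qed.

Lemma sum_arith n a b : (2 * (\sum_(i < n) (a + b * i)) + b * n = 2 * a * n + b * n * n)%N.
Proof.
elim: n => [|n IHn]; first by rewrite big_ord0; lia.
rewrite big_ord_recr /=; move: IHn; move: (\sum_(i < n) _)%N => s; nia.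
Qed.

Lemma phi_congr n : congr_pow q (2 * n).+1
  (qpoch (q ^+ 2) n * \prod_(i < n) (1 + q ^+ (2 * i).+1) ^+ 2)
  (\sum_(x <- zrange n (2 * n).+1) q ^+ phi_exp x).
Proof.
rewrite big_map big_mkord.
case: n => [|n].
  rewrite /qpoch !big_ord0 big_ord1 /=; exists 0; rewrite /phi_exp /=; ring.
have -> : (2 * n.+1 = (2 * n).+2)%N by lia.
apply: (theta_congr (e := (\sum_(i < n.+1) ((2 * n).+1 + 2 * i))%N)
  (f := fun k => phi_exp (k%:Z - n.+1%:Z))).
  have -> : (2 * n).+2 = (n.+1 + n.+1)%N by lia.
  rewrite big_split_ord /= (reindex_inj rev_ord_inj) /= -big_split /= -prodrXr.
  rewrite (reindex_inj (F := fun i : 'I__ => q ^+ _) rev_ord_inj) /= -big_split /=.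
  apply: eq_bigr => i _; have lt_i := ltn_ord i.
  rewrite -!exprM.
  have -> : ((2 * n).+1 = (2 * i).+1 + 2 * (n.+1 - i.+1))%N by lia.
  have -> : (2 * (n.+1 + i) = (2 * i).+1 + ((2 * i).+1 + 2 * (n.+1 - i.+1)))%N by lia.
  rewrite !exprD; ring.
move=> k le_k.
have binE : (2 * 'C(k, 2) + k = k * k)%N.
  by have := mul_bin_diag k 1; rewrite bin1 => <-; case: (k) => //= m; nia.
have := sum_arith n.+1 (2 * n).+1 2; rewrite /phi_exp.
move: (\sum_(i < _) _)%N 'C(k, 2) binE => s b binE sE.
have [[d E]|[d E]] : (exists d, n.+1 = k + d)%N \/ (exists d, k = n.+1 + d)%N.
- by have [/subnKC <-|/ltnW/subnKC <-] := leqP k n.+1; [left|right]; eexists.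
- have sq : (2 * d <= d * d + 1)%N by case: (d) => [//|m]; nia.
  have -> : absz ((k%:Z - n.+1%:Z) * (k%:Z - n.+1%:Z)) = (d * d)%N.
    by have -> : k%:Z - n.+1%:Z = - d%:Z by [lia]; rewrite mulrNN -PoszM absz_nat.
  have -> : minn k ((2 * n).+2 - k) = k by lia.
  have -> : ((2 * n).+2 - k = k + 2 * d)%N by lia.
  have nE1: (n.+1 * n.+1 = (k + d) * (k + d))%N by rewrite E.
  have nE2: (n.+1 * k = (k + d) * k)%N by rewrite E.
  have nE3: (n.+1 * d = (k + d) * d)%N by rewrite E.
  split; first nia.
  split; lia.
have sq : (2 * d <= d * d + 1)%N by case: (d) => [//|m]; nia.
have -> : absz ((k%:Z - n.+1%:Z) * (k%:Z - n.+1%:Z)) = (d * d)%N.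
  by have -> : k%:Z - n.+1%:Z = d%:Z by [lia]; rewrite -PoszM absz_nat.
have [c nE] : exists c, n.+1 = (c + d)%N by exists (n.+1 - d)%N; lia.
have -> : minn k ((2 * n).+2 - k) = c by lia.
have -> : ((2 * n).+2 - k = c)%N by lia.
have nE1: (n.+1 * n.+1 = (c + d) * (c + d))%N by rewrite nE.
split; first nia.
split; lia.
Qed.

Lemma psi_congr n : congr_pow q (2 * n).+2
  (qpoch (q ^+ 2) n * (2%:R * \prod_(i < n) (1 + q ^+ (2 * i.+1)) ^+ 2))
  (\sum_(x <- zrange n (2 * n).+2) q ^+ psi_exp x).
Proof.
rewrite big_map big_mkord.
apply: (theta_congr (e := (2 * n + \sum_(i < n) (2 * n + 2 * i))%N)
  (f := fun k => psi_exp (k%:Z - n%:Z))).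
  have -> : (2 * n).+1 = (n + n.+1)%N by lia.
  rewrite big_split_ord /= big_ord_recl /= addn0 (reindex_inj rev_ord_inj) /=.
  set A := \prod_(i < n) _; set B := \prod_(i < n) _; set P := \prod_(i < n) _.
  have AB : A * B = q ^+ (\sum_(i < n) (2 * n + 2 * i)) * P.
    rewrite /A /B /P -prodrXr.
    rewrite (reindex_inj (F := fun i : 'I__ => q ^+ _) rev_ord_inj) /= -!big_split /=.
    apply: eq_bigr => i _; have lt_i := ltn_ord i.
    rewrite -!exprM /bump /=.
    have -> : (2 * n = 2 * i.+1 + 2 * (n - i.+1))%N by lia.
    have -> : (2 * (n + (1 + i)) = 2 * i.+1 + (2 * i.+1 + 2 * (n - i.+1)))%N by lia.
    rewrite !exprD; ring.
  rewrite mulrCA AB exprD -exprM; ring.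
move=> k le_k.
have binE : (2 * 'C(k, 2) + k = k * k)%N.
  by have := mul_bin_diag k 1; rewrite bin1 => <-; case: (k) => //= m; nia.
have := sum_arith n (2 * n) 2; rewrite /psi_exp.
move: (\sum_(i < _) _)%N 'C(k, 2) binE => s b binE sE.
have [[d E]|[d E]] : (exists d, n = k + d)%N \/ (exists d, k = n.+1 + d)%N.
- by have [/subnKC <-|/subnKC <-] := leqP k n; [left|right]; eexists.
- have sq : (d <= d * d)%N by nia.
  have -> : absz ((k%:Z - n%:Z) * (k%:Z - n%:Z - 1)) = (d * d.+1)%N.
    have -> : k%:Z - n%:Z = - d%:Z by lia.
    have -> : - d%:Z - 1 = - d.+1%:Z by lia.
    by rewrite mulrNN -PoszM absz_nat.
  have -> : minn k ((2 * n).+1 - k) = k by lia.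
  have -> : ((2 * n).+1 - k = k + (2 * d).+1)%N by lia.
  rewrite E in sE *.
  split; first nia.
  split; lia.
have sq : (d <= d * d)%N by nia.
have -> : absz ((k%:Z - n%:Z) * (k%:Z - n%:Z - 1)) = (d.+1 * d)%N.
  have -> : k%:Z - n%:Z = d.+1%:Z by lia.
  have -> : d.+1%:Z - 1 = d%:Z by lia.
  by rewrite -PoszM absz_nat.
have [c nE] : exists c, n = (c + d)%N by exists (n - d)%N; lia.
have -> : minn k ((2 * n).+1 - k) = c by lia.
have -> : ((2 * n).+1 - k = c)%N by lia.
rewrite E nE in sE binE *.
split; first nia.
split; lia.
Qed.

End Theta.

Lemma phi_expE x : (phi_exp x)%:Z = x * x.
Proof. rewrite /phi_exp; nia. Qed.

Lemma psi_expE x : (psi_exp x)%:Z = x * (x - 1).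
Proof. rewrite /psi_exp; nia. Qed.

Lemma psi_exp_even x : ~~ odd (psi_exp x).
Proof.
have [y [E|E]] : exists y : int, x = 2 * y \/ x = 2 * y + 1 by exists (x %/ 2)%Z; lia.
- have : (psi_exp x)%:Z = 2 * (y * (x - 1)) by rewrite psi_expE {1}E; ring.
  move: (y * _) => z; lia.
- have : (psi_exp x)%:Z = 2 * (x * y) by rewrite psi_expE [X in X - 1]E; ring.
  move: (x * _) => z; lia.
Qed.

Lemma leq_count_inj (T U : eqType) (s : seq T) (t : seq U) (a : pred T) (b : pred U)
    (f : T -> U) (g : U -> T) :
  uniq s -> (forall x, a x -> [/\ f x \in t, b (f x) & g (f x) = x]) ->
  (count a s <= count b t)%N.
Proof.
move=> us fP; rewrite -!size_filter -(size_map f); apply: uniq_leq_size.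
- rewrite map_inj_in_uniq ?filter_uniq // => x y.
  rewrite !mem_filter => /andP[ax _] /andP[ay _] E.
  by have [_ _ <-] := fP x ax; have [_ _ <-] := fP y ay; rewrite E.
- move=> _ /mapP[x + ->]; rewrite !mem_filter => /andP[ax _].
  by have [-> -> _] := fP x ax.
Qed.

Lemma count_bij (T U : eqType) (s : seq T) (t : seq U) (a : pred T) (b : pred U)
    (f : T -> U) (g : U -> T) :
  uniq s -> uniq t ->
  (forall x, a x -> [/\ f x \in t, b (f x) & g (f x) = x]) ->
  (forall y, b y -> [/\ g y \in s, a (g y) & f (g y) = y]) ->
  count a s = count b t.
Proof.
move=> us ut fP gP; apply/eqP; rewrite eqn_leq.
by rewrite (leq_count_inj us fP) (leq_count_inj ut gP).
Qed.

Lemma count_split (T : Type) (a b : pred T) s :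
  count a s = (count (predI a b) s + count (predI a (predC b)) s)%N.
Proof. by elim: s => //= x s ->; case: (a x); case: (b x) => /=; lia. Qed.

Definition phi_box (L : nat) : seq (int * int) :=
  [seq (x, y) | x <- zrange (3 * L) (6 * L).+1, y <- zrange L (2 * L).+1].

Definition psi_box (L : nat) : seq (int * int) :=
  [seq (x, y) | x <- zrange (3 * L) (6 * L).+2, y <- zrange L (2 * L).+2].

Definition phi_form (p : int * int) : nat := phi_exp p.1 + 3 * phi_exp p.2.
Definition psi_form (p : int * int) : nat := psi_exp p.1 + 3 * psi_exp p.2.

Lemma phi_formE x y : (phi_form (x, y))%:Z = x * x + 3 * (y * y).
Proof. by rewrite /phi_form PoszD PoszM !phi_expE. Qed.

Lemma psi_formE x y : (psi_form (x, y))%:Z = x * (x - 1) + 3 * (y * (y - 1)).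
Proof. by rewrite /psi_form PoszD PoszM !psi_expE. Qed.

Lemma phi_box_uniq L : uniq (phi_box L).
Proof. by apply: allpairs_uniq => [||[? ?] [? ?]] //; apply: zrange_uniq. Qed.

Lemma psi_box_uniq L : uniq (psi_box L).
Proof. by apply: allpairs_uniq => [||[? ?] [? ?]] //; apply: zrange_uniq. Qed.

Lemma mem_phi_box L p : (phi_form p <= 6 * L)%N -> p \in phi_box L.
Proof.
case: p => x y le; apply/allpairsP; exists (x, y).
have /= {le} := le; have := phi_formE x y; move: (phi_form _) => i E le.
by rewrite !mem_zrange; split=> //=; nia.
Qed.

Lemma mem_psi_box L p : (psi_form p <= 6 * L)%N -> p \in psi_box L.
Proof.
case: p => x y le; apply/allpairsP; exists (x, y).
have := psi_exp_even x; have := psi_exp_even y.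
have := psi_expE x; have := psi_expE y; move: le; rewrite /psi_form /=.
move: (psi_exp x) (psi_exp y) => i j le Ej Ei _ _.
by rewrite !mem_zrange; split=> //=; nia.
Qed.

(* Factoring in the Eisenstein integers: for [a = 2j - 1] and [b = 2l - 1] with
   [j - l] even, [a + b sqrt(-3)] is [1 + sqrt(-3)] times a conjugate of [x + y sqrt(-3)],
   whence [a ^ 2 + 3 b ^ 2 = 4 (x ^ 2 + 3 y ^ 2)]; the symmetry [b -> - b], which is
   [l -> 1 - l], exchanges the cases [j - l] even and [j - l] odd. *)
Lemma count_psi_form L i : (i < 6 * L)%N ->
  count [pred p | psi_form p == i] (psi_box L) =
  ((if odd i then 0 else 2) * count [pred p | phi_form p == i.+1] (phi_box L))%N.
Proof.
move=> lt_i; case: ifP => [odd_i|even_i].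
  rewrite mul0n; apply/eqP; rewrite -leqn0 leqNgt -has_count; apply/hasPn => p _ /=.
  apply/eqP => E; move: odd_i; rewrite -E /psi_form oddD oddM /=.
  by rewrite (negPf (psi_exp_even _)) (negPf (psi_exp_even _)).
rewrite mul2n -addnn (count_split _ (fun p : int * int => (p.1 - p.2) %% 2 == 0)%Z).
pose f (p : int * int) : int * int := let l : int := ((p.1 - p.2 + 1) %/ 2)%Z in (l + 2 * p.2, l).
pose g (p : int * int) : int * int := let y : int := ((p.1 - p.2) %/ 2)%Z in (2 * p.2 + y - 1, y).
pose r (p : int * int) : int * int := (p.1, 1 - p.2).
have fP p : phi_form p = i.+1 ->
    [/\ psi_form (f p) = i, (((f p).1 - (f p).2) %% 2)%Z = 0 & g (f p) = p].
  case: p => x y E; rewrite /f /g /=; have := phi_formE x y; rewrite E => {}E.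
  have [l xE] : exists l : int, x = 2 * l + y - 1.
    exists ((x - y + 1) %/ 2)%Z.
    have [z [zE|zE]] : exists z : int, x - y = 2 * z + 1 \/ x - y = 2 * z
      by exists ((x - y) %/ 2)%Z; lia.
      lia.
    have xE : x = y + 2 * z by lia.
    rewrite xE in E.
    have E' : i.+1 = 2 * (2 * y * y + 2 * y * z + 2 * z * z) :> int by rewrite E; ring.
    move: (2 * y * y + 2 * y * z + 2 * z * z) E' => w; lia.
  have -> : ((x - y + 1) %/ 2)%Z = l by lia.
  split; first 1 last; [lia | congr pair; lia |].
  have : (psi_form (l + 2 * y, l))%:Z + 1 = i.+1%:Z by rewrite psi_formE E xE; ring.
  move: (psi_form _) => k; lia.
have gP p : psi_form p = i -> ((p.1 - p.2) %% 2)%Z = 0 -> phi_form (g p) = i.+1 /\ f (g p) = p.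
  case: p => j l E /= jl; rewrite /f /g /=; have := psi_formE j l; rewrite E => {}E.
  have [y jE] : exists y : int, j = l + 2 * y by exists ((j - l) %/ 2)%Z; lia.
  have -> : ((j - l) %/ 2)%Z = y by lia.
  split; last by congr pair; lia.
  have : (phi_form (2 * l + y - 1, y))%:Z = i%:Z + 1 by rewrite phi_formE E jE; ring.
  move: (phi_form _) => k; lia.
have rP p : psi_form (r p) = psi_form p.
  case: p => j l; rewrite /r /=.
  have : (psi_form (j, 1 - l))%:Z = (psi_form (j, l))%:Z by rewrite !psi_formE; ring.
  by case.
have rK : involutive r by case=> j l; rewrite /r /= subKr.
have in_phi p : phi_form p = i.+1 -> p \in phi_box L by move=> E; apply: mem_phi_box; lia.
have in_psi p : psi_form p = i -> p \in psi_box L by move=> E; apply: mem_psi_box; lia.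
congr (_ + _)%N.
  apply: (count_bij (f := g) (g := f)); try exact: phi_box_uniq; try exact: psi_box_uniq.
    move=> p /andP[/eqP E /eqP par]; have [E1 E2] := gP p E par.
    by split; [exact: in_phi | rewrite /= E1 | ].
  move=> p /eqP E; have [E1 E2 E3] := fP p E.
  by split; [exact: in_psi | rewrite /= E1 E2 !eqxx | ].
apply: (count_bij (f := g \o r) (g := r \o f)); try exact: phi_box_uniq; try exact: psi_box_uniq.
  move=> p /andP[/eqP E /= par].
  have [E1 E2] : phi_form (g (r p)) = i.+1 /\ f (g (r p)) = r p.
    by apply: gP; [rewrite rP|rewrite /r /=; lia].
  by split; [exact: in_phi | rewrite /= E1 | rewrite /= E2 rK].
move=> p /eqP E; have [E1 E2 E3] := fP p E.
split; [by apply: in_psi; rewrite rP | | by rewrite /= rK].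
by rewrite /= rP E1 eqxx /r /=; lia.
Qed.

Lemma coef_congr (M i : nat) (p r : {poly int}) :
  congr_pow 'X M p r -> (i < M)%N -> p`_i = r`_i.
Proof. by move=> [h ->] lt_i; rewrite coefD coefXnM lt_i addr0. Qed.

Lemma congr_coef (M : nat) (p r : {poly int}) :
  (forall i, (i < M)%N -> p`_i = r`_i) -> congr_pow 'X M p r.
Proof.
move=> pr; exists (drop_poly M (p - r)).
suff E : take_poly M (p - r) = 0.
  by rewrite -[LHS](subrK r) -{1}(poly_take_drop M (p - r)) E; ring.
by apply/polyP => i; rewrite coef_take_poly coef0 coefB; case: ifP => // /pr ->; rewrite subrr.
Qed.

Definition gf_factor (u : int) (k : nat) : {poly int} := 1 + u *: 'X^k.

Definition gf (u : int) (m : nat -> nat) (K : nat) : {poly int} :=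
  \prod_(k < K) gf_factor u k.+1 ^+ m k.+1.

Lemma gf_dpart (u : int) (m : nat -> nat) (N : nat) : (forall k, m k <= 4)%N ->
  (gf u m N)`_N = \sum_(A : {set 'I_N.+1 * 'I_4} | is_dpart m A) u ^+ #|A|.
Proof.
move=> m4.
pose valid (x : 'I_N.+1 * 'I_4) := (0 < x.1)%N && (x.2 < m x.1)%N.
have -> : gf u m N = \prod_(x : 'I_N.+1 * 'I_4) ((if valid x then u *: 'X^(x.1) else 0) + 1).
  rewrite -(pair_bigA _ (fun i j => (if valid (i, j) then u *: 'X^i else 0) + 1)) /=.
  rewrite big_ord_recl /= big1 ?mul1r => [|j _]; last by rewrite add0r.
  apply: eq_bigr => k _; rewrite -[X in _ ^+ X]card_ord -prodr_const.
  rewrite (big_ord_widen 4 (fun=> gf_factor u k.+1)) // big_mkcond /=.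
  by apply: eq_bigr => j _; rewrite /valid /=; case: ifP; rewrite ?add0r // addrC.
rewrite bigA_distr /= coef_sum [RHS]big_mkcond; apply: eq_bigr => A _.
rewrite -big_mkcond /= /is_dpart.
case: ifP => [/andP[/forall_inP vA /eqP sA]|].
  rewrite (eq_bigr (fun x : 'I_N.+1 * 'I_4 => u%:P * 'X^(x.1))) => [|x /vA vx].
    rewrite big_split /= prodr_const prodrXr.
    by rewrite sA -polyC_exp coefCM coefXn eqxx mulr1.
  by rewrite /valid vx mul_polyC.
move/negbT; rewrite negb_and => /orP[|nA].
  move=> /forall_inPn[x xA nx].
  by rewrite (bigD1 x) //= /valid (negPf nx) mul0r coef0.
have [/forall_inP vA|/forall_inPn[x xA nx]] := boolP [forall x in A, valid x].
  rewrite (eq_bigr (fun x : 'I_N.+1 * 'I_4 => u%:P * 'X^(x.1))) => [|x /vA ->].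
    rewrite big_split /= prodr_const prodrXr.
    by rewrite -polyC_exp coefCM coefXn eq_sym (negPf nA) mulr0.
  by rewrite mul_polyC.
by rewrite (bigD1 x) //= (negPf nx) mul0r coef0.
Qed.

Lemma gf_congr (u : int) (m : nat -> nat) (N K : nat) : (N <= K)%N ->
  congr_pow 'X N.+1 (gf u m K) (gf u m N).
Proof.
move/subnKC <-; rewrite /gf big_split_ord /= -[X in congr_pow _ _ _ X]mulr1.
apply: congr_powM; first exact: congr_pow_refl.
apply: congr_pow_prod1 => i _; apply: congr_pow_exp1; exists (u%:P * 'X^i).
by rewrite /gf_factor -addSn exprD -mul_polyC; ring.
Qed.

Lemma mS_le4 k : (mS k <= 4)%N.
Proof. by rewrite /mS; case: ifP => //; case: ifP. Qed.

Lemma mT_le4 k : (mT k <= 4)%N.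
Proof. by rewrite /mT; case: ifP => //; case: ifP. Qed.

Lemma D_gf (m : nat -> nat) N K : (forall k, m k <= 4)%N -> (N <= K)%N ->
  (gf 1 m K)`_N = (D m N)%:R.
Proof.
move=> m4 le_NK; rewrite (coef_congr (gf_congr 1 m le_NK)) // gf_dpart //.
under eq_bigr do rewrite expr1n.
by rewrite sumr_const /D cardsE.
Qed.

Lemma D_odd_gf (m : nat -> nat) N K : (forall k, m k <= 4)%N -> (N <= K)%N ->
  (gf 1 m K - gf (-1) m K)`_N = (2 * D_odd m N)%:R.
Proof.
move=> m4 le_NK; rewrite coefB !(coef_congr (gf_congr _ m le_NK)) // !gf_dpart //.
rewrite -sumrB natrM /D_odd cardsE.
rewrite -sum1_card natr_sum mulr_sumr [LHS]big_mkcond [RHS]big_mkcond.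
apply: eq_bigr => A _; rewrite unfold_in /=; case: is_dpart => //=.
by rewrite expr1n -signr_odd; case: odd.
Qed.

Lemma gf_mS u L : gf u mS (6 * L) =
  \prod_(i < 3 * L) gf_factor u (2 * i).+1 ^+ 2 * \prod_(i < L) gf_factor u (6 * i + 3) ^+ 2.
Proof.
elim: L => [|L IHL]; first by rewrite /gf !muln0 !big_ord0 mulr1.
have e6 : (6 * L.+1 = (6 * L).+4.+2)%N by lia.
have e3 : (3 * L.+1 = (3 * L).+3)%N by lia.
rewrite /gf e6 e3 !big_ord_recr /= -/(gf u mS (6 * L)) IHL.
have [-> -> -> -> ->] : [/\ mS (6 * L).+1 = 2, mS (6 * L).+2 = 0, mS (6 * L).+3 = 4,
    mS (6 * L).+4 = 0 & mS (6 * L).+4.+1 = 2]%N.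
  by split; rewrite /mS; case: ifP; try case: ifP; lia.
have -> : mS (6 * L).+4.+2 = 0%N by rewrite /mS; case: ifP; try case: ifP; lia.
have -> : ((2 * (3 * L)).+1 = (6 * L).+1)%N by lia.
have -> : ((2 * (3 * L).+1).+1 = (6 * L).+3)%N by lia.
have -> : ((2 * (3 * L).+2).+1 = (6 * L).+4.+1)%N by lia.
rewrite addn3; ring.
Qed.

Lemma gf_mT u L : gf u mT (6 * L) =
  \prod_(i < 3 * L) gf_factor u (2 * i.+1) ^+ 2 * \prod_(i < L) gf_factor u (6 * i.+1) ^+ 2.
Proof.
elim: L => [|L IHL]; first by rewrite /gf !muln0 !big_ord0 mulr1.
have e6 : (6 * L.+1 = (6 * L).+4.+2)%N by lia.
have e3 : (3 * L.+1 = (3 * L).+3)%N by lia.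
rewrite /gf [in LHS]e6 e3 !big_ord_recr /= -/(gf u mT (6 * L)) IHL.
have [-> -> -> -> ->] : [/\ mT (6 * L).+1 = 0, mT (6 * L).+2 = 2, mT (6 * L).+3 = 0,
    mT (6 * L).+4 = 2 & mT (6 * L).+4.+1 = 0]%N.
  by split; rewrite /mT; case: ifP; try case: ifP; lia.
have -> : mT (6 * L).+4.+2 = 4%N by rewrite /mT; case: ifP; try case: ifP; lia.
have -> : (2 * (3 * L).+1 = (6 * L).+2)%N by lia.
have -> : (2 * (3 * L).+2 = (6 * L).+4)%N by lia.
have -> : (2 * (3 * L).+3 = (6 * L).+4.+2)%N by lia.
rewrite e6; ring.
Qed.

Lemma gf_phi (u : int) L : u ^+ 2 = 1 ->
  congr_pow 'X (6 * L)
    (qpoch ('X ^+ 2) (3 * L) * qpoch ('X ^+ 6) L * gf u mS (6 * L))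
    (\sum_(p <- phi_box L) (u *: 'X) ^+ phi_form p).
Proof.
move=> u2; set q : {poly int} := u *: 'X.
have u_odd k : odd k -> u ^+ k = u.
  by move=> k_odd; rewrite -[k]odd_double_half k_odd exprS -mul2n exprM u2 expr1n mulr1.
have u_neq0 : u != 0 by apply/eqP => u0; move: u2; rewrite u0 expr0n.
have q_neq0 : q != 0 by rewrite /q -mul_polyC mulf_eq0 polyC_eq0 polyX_eq0 (negPf u_neq0).
have q2 : q ^+ 2 = 'X ^+ 2 by rewrite /q exprZn u2 scale1r.
have q32 : (q ^+ 3) ^+ 2 = 'X ^+ 6 by rewrite exprAC q2 -exprM.
have qXM M p r : congr_pow q M p r -> congr_pow 'X M p r.
  case=> h ->; exists (u ^+ M *: h).
  by rewrite /q exprZn -scalerAl scalerAr.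
have -> : \sum_(p <- phi_box L) q ^+ phi_form p =
    (\sum_(x <- zrange (3 * L) (6 * L).+1) q ^+ phi_exp x) *
    (\sum_(y <- zrange L (2 * L).+1) (q ^+ 3) ^+ phi_exp y).
  rewrite big_allpairs mulr_suml; apply: eq_bigr => x _.
  by rewrite mulr_sumr; apply: eq_bigr => y _; rewrite -exprM -exprD.
apply: qXM.
have c1 := @phi_congr _ q q_neq0 (3 * L).
have c2 := @phi_congr _ (q ^+ 3) (expf_neq0 3 q_neq0) L.
rewrite mulnA -[(2 * 3)%N]/6%N q2 in c1; rewrite q32 in c2.
rewrite gf_mS mulrACA; apply: congr_powM.
  have -> : \prod_(i < 3 * L) gf_factor u (2 * i).+1 ^+ 2 =
            \prod_(i < 3 * L) (1 + q ^+ (2 * i).+1) ^+ 2.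
    apply: eq_bigr => i _; rewrite /gf_factor /q exprZn u_odd //= mul2n.
    by rewrite odd_double.
  by rewrite -[q]expr1 in c1 *; apply: congr_pow_weaken c1; lia.
have -> : \prod_(i < L) gf_factor u (6 * i + 3) ^+ 2 =
          \prod_(i < L) (1 + (q ^+ 3) ^+ (2 * i).+1) ^+ 2.
  apply: eq_bigr => i _; rewrite -exprM.
  have -> : (3 * (2 * i).+1 = 6 * i + 3)%N by lia.
  by rewrite /gf_factor /q exprZn u_odd //; lia.
by apply: congr_pow_weaken c2; lia.
Qed.

Lemma gf_psi L :
  congr_pow 'X (6 * L)
    (qpoch ('X ^+ 2) (3 * L) * qpoch ('X ^+ 6) L * (4%:R * gf 1 mT (6 * L)))
    (\sum_(p <- psi_box L) 'X ^+ psi_form p).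
Proof.
have -> : \sum_(p <- psi_box L) 'X ^+ psi_form p =
    (\sum_(x <- zrange (3 * L) (6 * L).+2) 'X ^+ psi_exp x) *
    (\sum_(y <- zrange L (2 * L).+2) ('X ^+ 3) ^+ psi_exp y) :> {poly int}.
  rewrite big_allpairs mulr_suml; apply: eq_bigr => x _.
  by rewrite mulr_sumr; apply: eq_bigr => y _; rewrite -exprM -exprD.
have X_neq0 : 'X != 0 :> {poly int} by rewrite polyX_eq0.
have c1 := @psi_congr _ _ X_neq0 (3 * L).
have c2 := @psi_congr _ _ (expf_neq0 3 X_neq0) L.
rewrite mulnA -[(2 * 3)%N]/6%N in c1; rewrite -exprM in c2.
have regroup (a b c d : {poly int}) :
  a * b * (4%:R * (c * d)) = a * (2%:R * c) * (b * (2%:R * d)) by ring.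
rewrite gf_mT regroup; apply: congr_powM.
  have -> : \prod_(i < 3 * L) gf_factor 1 (2 * i.+1) ^+ 2 =
            \prod_(i < 3 * L) (1 + 'X ^+ (2 * i.+1)) ^+ 2.
    by apply: eq_bigr => i _; rewrite /gf_factor scale1r.
  by rewrite -['X]expr1 in c1; apply: congr_pow_weaken c1; lia.
have -> : \prod_(i < L) gf_factor 1 (6 * i.+1) ^+ 2 =
          \prod_(i < L) (1 + ('X ^+ 3) ^+ (2 * i.+1)) ^+ 2.
  by apply: eq_bigr => i _; rewrite /gf_factor scale1r -exprM mulnA.
by apply: congr_pow_weaken c2; lia.
Qed.

Lemma coef_sum_exp (s : seq (int * int)) (f : int * int -> nat) (u : int) i :
  (\sum_(p <- s) (u *: 'X) ^+ f p)`_i = u ^+ i * (count [pred p | f p == i] s)%:R.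
Proof.
rewrite coef_sum -sum1_count natr_sum mulr_sumr [RHS]big_mkcond; apply: eq_bigr => p _.
rewrite exprZn coefZ coefXn /= eq_sym.
by case: eqP => [->|]; rewrite ?mulr1 ?mulr0.
Qed.

Lemma gf_identity L :
  congr_pow 'X (6 * L) (gf 1 mS (6 * L) - gf (-1) mS (6 * L)) ('X * (4%:R * gf 1 mT (6 * L))).
Proof.
set E : {poly int} := qpoch ('X ^+ 2) (3 * L) * qpoch ('X ^+ 6) L.
have E1 : congr_pow 'X 1 E 1.
  rewrite -(mulr1 1); apply: congr_powM.
    exact: congr_pow_weaken (qpoch_congr1 _ _).
  exact: congr_pow_weaken (qpoch_congr1 _ _).
apply: (congr_pow_cancel E1); rewrite mulrBr mulrCA.
have c1 := @gf_phi 1 L (expr1n _ _).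
have c2 := @gf_phi (-1) L (sqrrN 1).
apply: congr_pow_trans (congr_powB c1 c2) _.
apply: congr_pow_trans (congr_pow_sym (congr_powM (congr_pow_refl _ _ _) (gf_psi L))).
apply: congr_coef => i lt_i; rewrite coefB !coef_sum_exp coefXM.
case: i lt_i => [|i] lt_i; first by rewrite !expr0 subrr.
under eq_bigr do rewrite -['X]scale1r.
rewrite coef_sum_exp count_psi_form; last by lia.
rewrite !expr1n -signr_odd /=; case: (odd i) => /=; rewrite ?expr0 ?expr1 ?mul0n; ring.
Qed.

Local Close Scope ring_scope.

Theorem theorem3p6 (N : nat) : 1 <= N -> D_S N = 2 * D_T (N - 1).
Proof.
case: N => // N _; rewrite subn1 /=.
have lt_N : (N.+1 < 6 * N.+1)%N by lia.
have := coef_congr (gf_identity N.+1) lt_N.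
rewrite D_odd_gf; [|exact: mS_le4|lia].
rewrite coefXM /= mulr_natl coefMn D_gf; [|exact: mT_le4|lia].
rewrite -[(_ *+ 4)%R]mulr_natl -natrM /D_S /D_T => /eqP; rewrite Num.Theory.eqr_nat; lia.
Qed.
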